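(* Let $\mathbf{A}=(A;\leq,{}',0,1)$ be a De Morgan poset and $G$ a partial mapping of $A$ into itself satisfying: (i) $G(0)=0$ and $G(1)=1$; (ii) $x\leq y$ implies $G(x)\leq G(y)$ whenever $G(x),G(y)$ exist; (iii) $x\leq y$ implies $G(x)\leq F(y)$ whenever $G(y')$ and $G(x)$ exist, where $F$ is the partial map defined on $\{y\mid y'\in\mathrm{dom}(G)\}$ by $F(y)=G(y')'$. Put $$R_G=\{(s,t)\in T_{\mathbf A}^{\mathrm{DMP}}\times T_{\mathbf A}^{\mathrm{DMP}}\mid \forall x\in\mathrm{dom}(G):\ s(G(x))\leq t(x)\}.$$ Then $(T_{\mathbf A}^{\mathrm{DMP}},R_G)$ is a frame with $R_G$ serial. Moreover, let $\widehat G$ be the operator on $M_2^{T_{\mathbf A}^{\mathrm{DMP}}}$ given by $\widehat G(p)(s)=\bigwedge_{M_2}\{p(t)\mid s\mathrel{R_G}t\}$ and let $\widehat F(p)=\widehat G(p')'$. Then the map $i_{\mathbf A}\colon A\to M_2^{T_{\mathbf A}^{\mathrm{DMP}}}$, $i_{\mathbf A}(a)(s)=s(a)$, is an order-reflecting morphism of De Morgan posets into the complete De Morgan lattice $\mathbf{M}_2^{T_{\mathbf A}^{\mathrm{DMP}}}$ such that $i_{\mathbf A}(G(a))=\widehat G(i_{\mathbf A}(a))$ for all $a\in\mathrm{dom}(G)$ and $i_{\mathbf A}(F(a))=\widehat F(i_{\mathbf A}(a))$ for all $a\in\mathrm{dom}(F)$.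
   Context: A De Morgan poset is a structure $(A;\leq,{}',0,1)$ where $(A;\leq)$ is a poset with least element $0$ and greatest element $1$, and $'$ is a unary operation with $a\leq b\Rightarrow b'\leq a'$ and $a''=a$. A morphism of De Morgan posets preserves order, negation, $0$ and $1$; it is order reflecting if $f(a)\leq f(b)$ iff $a\leq b$. A frame is a pair $(T,R)$ with $T$ a non-empty set and $R$ a binary relation on $T$; $R$ is serial if for every $x\in T$ there is $y\in T$ with $x\mathrel{R}y$. $\mathbf{M}_2$ is the four-element complete De Morgan lattice on $\{0,1\}\times\{0,1\}$ with componentwise order and negation $(a,b)'=(1-b,1-a)$; $\mathbf{M}_2^T$ is the direct power with componentwise order and negation. For a proper down-set $D$ of $\mathbf A$ (a down-set with $0\in D$, $1\notin D$) let $h_D\colon A\to\{0,1\}$, $h_D(a)=0$ iff $a\in D$, let $h_D^{\partial}(a)=1-h_D(a')$, and $\kappa_D(a)=(h_D(a),h_D^{\partial}(a))\in M_2$. $T_{\mathbf A}^{\mathrm{DMP}}$ is the set of all $\kappa_D$, $D$ ranging over proper down-sets of $\mathbf A$.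
   Formalization: The claim that the pair of T and R_G is a frame (T non-empty) is stated only when 0 ≠ 1 in A, since for the one-element De Morgan poset there is no proper down-set and T is empty; all other claims are stated for every A. *)

(* Defs.v *)
From HB Require Import structures.
From mathcomp Require Import all_boot all_order.
From mathcomp Require Import boolp classical_sets.

Set Implicit Arguments.
Unset Strict Implicit.
Unset Printing Implicit Defensive.

Import Order.Theory.
Local Open Scope order_scope.
Local Open Scope classical_set_scope.

(* Carriers are classical: boolp makes every type a choiceType and every Prop-valued
   order boolean, so tbPOrderType is no restriction on bounded posets. *)
HB.mixin Record isDeMorgan (d : Order.disp_t) T of Order.TBPOrder d T := {
  dmneg : T -> T;
  dmneg_anti : forall a b : T, a <= b -> dmneg b <= dmneg a;
  dmnegK : forall a : T, dmneg (dmneg a) = a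
}.

#[short(type="deMorganPosetType")]
HB.structure Definition DeMorganPoset (d : Order.disp_t) :=
  { T of isDeMorgan d T & Order.TBPOrder d T }.

Definition dm_morphism (d d' : Order.disp_t)
    (A : deMorganPosetType d) (B : deMorganPosetType d') (f : A -> B) : Prop :=
  [/\ forall a b : A, a <= b -> f a <= f b,
      forall a : A, f (dmneg a) = dmneg (f a),
      f \bot = \bot
    & f \top = \top].

Definition order_reflecting (d d' : Order.disp_t)
    (A : porderType d) (B : porderType d') (f : A -> B) : Prop :=
  forall a b : A, f a <= f b <-> a <= b.

Definition complete_lattice (d : Order.disp_t) (L : porderType d) : Prop :=
  forall S : set L, infimums S !=set0 /\ supremums S !=set0.

(* M_2, with 0, 1 rendered as false, true and the library's componentwise order. *)
Definition M2 : Type := (bool *p bool)%type.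

HB.instance Definition _ := Order.FinTBLattice.on M2.

Definition M2neg (m : M2) : M2 := (~~ m.2, ~~ m.1).

Fact M2neg_anti (a b : M2) : a <= b -> M2neg b <= M2neg a.
Proof. by case: a b => [[] []] [[] []]. Qed.

Fact M2negK (a : M2) : M2neg (M2neg a) = a.
Proof. by case: a => [[] []]. Qed.

HB.instance Definition _ := isDeMorgan.Build _ M2 M2neg_anti M2negK.

Definition M2meet (S : set M2) : M2 := \meet_(m : M2 | m \in S) m.

Lemma M2meet_infimum (S : set M2) : infimums S (M2meet S).
Proof.
split=> [m Sm | m lb_m]; first by apply: meets_inf; rewrite inE.
by apply/meetsP => x; rewrite inE; apply: lb_m.
Qed.

(* The power L^I is I -> L, with the pointwise order of FunOrder. *)
Section Power.
Variables (I : Type) (d : Order.disp_t).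

Section Bounds.
Variable L : tbPOrderType d.

Fact le0f (f : I -> L) : ((fun=> \bot) : I -> L) <= f.
Proof. by apply/asboolP => x; apply: le0x. Qed.

Fact lef1 (f : I -> L) : f <= ((fun=> \top) : I -> L).
Proof. by apply/asboolP => x; apply: lex1. Qed.

HB.instance Definition _ := Order.hasBottom.Build _ (I -> L) le0f.
HB.instance Definition _ := Order.hasTop.Build _ (I -> L) lef1.
End Bounds.

Variable L : deMorganPosetType d.

Definition fneg (f : I -> L) : I -> L := fun x => dmneg (f x).

Fact fneg_anti (f g : I -> L) : f <= g -> fneg g <= fneg f.
Proof. by move/asboolP => fg; apply/asboolP => x; apply/dmneg_anti/fg. Qed.

Fact fnegK (f : I -> L) : fneg (fneg f) = f.
Proof. by apply/funext => x; apply: dmnegK. Qed.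

HB.instance Definition _ := isDeMorgan.Build _ (I -> L) fneg_anti fnegK.
End Power.

(* R is unconstrained: the only condition on a frame is that T is non-empty. *)
Definition is_frame (T : Type) (R : T -> T -> Prop) : Prop := [set: T] !=set0.

Definition serial (T : Type) (R : T -> T -> Prop) : Prop :=
  forall x : T, exists y : T, R x y.

Section FrameOperators.
Variables (T : Type) (R : T -> T -> Prop).

Definition hatG (p : T -> M2) : T -> M2 :=
  fun s => M2meet [set p t | t in [set t | R s t]].

Definition hatF (p : T -> M2) : T -> M2 := dmneg (hatG (dmneg p)).
End FrameOperators.

Section DMP.
Variables (d : Order.disp_t) (A : deMorganPosetType d).

Definition proper_downset (D : set A) : Prop :=
  [/\ forall a b : A, a <= b -> D b -> D a, D \bot & ~ D \top].

Definition hD (D : set A) (a : A) : bool := a \notin D.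

Definition hDdual (D : set A) (a : A) : bool := ~~ hD D (dmneg a).

Definition kappa (D : set A) (a : A) : M2 := (hD D a, hDdual D a).

(* Empty exactly when 0 = 1, since then no down-set is proper. *)
Definition T_DMP : set (A -> M2) := [set kappa D | D in proper_downset].

(* T_DMP is coerced to a type here, and val s : A -> M2. *)
Definition iA (a : A) : T_DMP -> M2 := fun s => val s a.

(* A partial map A -> A is a function A -> option A, None meaning "undefined". *)
Section PartialOperator.
Variable G : A -> option A.

Definition partialF (y : A) : option A := omap (@dmneg d A) (G (dmneg y)).

Definition R_G (s t : T_DMP) : Prop :=
  forall x gx : A, G x = Some gx -> val s gx <= val t x.
End PartialOperator.
End DMP.

Arguments T_DMP {d} A _.
Arguments iA {d A} a s.

(* Main.v *)
Require Import Defs.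
From HB Require Import structures.
From mathcomp Require Import all_boot all_order.
From mathcomp Require Import boolp classical_sets.
Import Order.Theory.
Local Open Scope order_scope.

Set Implicit Arguments.
Unset Strict Implicit.
Unset Printing Implicit Defensive.

(** If s = kappa_D and t = kappa_E, then s R_G t says exactly that the down-set
    E contains L = {z | z <= x' with G(x)' in D} and misses the up-set
    U = {z | x <= z with G(x) not in D}.  Condition (iii) makes L and U
    disjoint, so both L and the complement of U are proper down-sets related to
    D.  The first gives seriality; by (ii), the complement of U realises the
    meet defining hatG in the first coordinate of M_2 and L realises it in the
    second one. *)

Local Open Scope classical_set_scope.

Lemma M2_leP (m n : M2) : reflect ((m.1 -> n.1) /\ (m.2 -> n.2)) (m <= n).
Proof.
have le_implyb (b c : bool) : (b <= c) = (b ==> c) by case: b c => [] [].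
have -> : (m <= n) = (m.1 ==> n.1) && (m.2 ==> n.2) by rewrite -!le_implyb.
by apply: (iffP andP) => -[/implyP ? /implyP ?].
Qed.

Lemma dmnegT (d : Order.disp_t) (A : deMorganPosetType d) :
  dmneg \top = \bot :> A.
Proof.
by apply/le_anti; rewrite le0x andbT -[\bot]dmnegK; apply/dmneg_anti/lex1.
Qed.

Lemma dmneg0 (d : Order.disp_t) (A : deMorganPosetType d) :
  dmneg \bot = \top :> A.
Proof. by rewrite -dmnegT dmnegK. Qed.

Lemma fun_leP (I : Type) (d : Order.disp_t) (L : porderType d) (f g : I -> L) :
  f <= g <-> forall x, f x <= g x.
Proof. by split=> [/asboolP|?] //; apply/asboolP. Qed.

(** Infima and suprema are computed pointwise, in the finite lattice [M2]. *)
Lemma M2_power_complete (I : Type) : complete_lattice (I -> M2).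
Proof.
move=> S; pose ev (x : I) (f : I -> M2) := f x.
split.
- exists (fun x => M2meet (ev x @` S)); split=> [f Sf|f lb_f]; apply/fun_leP => x.
    by apply: (M2meet_infimum _).1; exists f.
  by apply: (M2meet_infimum _).2 => _ [g Sg <-]; apply: (fun_leP _ _).1 (lb_f g Sg) x.
- exists (fun x => \join_(m : M2 | m \in ev x @` S) m).
  split=> [f Sf|f ub_f]; apply/fun_leP => x.
    by apply: (@joins_sup _ _ _ (f x) _ id); rewrite inE; exists f.
  apply/joinsP => m; rewrite inE => -[g Sg <-].
  exact: (fun_leP _ _).1 (ub_f g Sg) x.
Qed.

Section DownsetPoints.
Variables (d : Order.disp_t) (A : deMorganPosetType d).
Implicit Types (D E : set A) (a b : A).

Lemma hDP D a : reflect (~ D a) (hD D a).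
Proof. by apply: (iffP idP); rewrite /hD notin_setE. Qed.

Lemma hDdualP D a : reflect (D (dmneg a)) (hDdual D a).
Proof. by rewrite /hDdual /hD negbK; apply: (iffP idP); rewrite inE. Qed.

Lemma kappa_mem D : proper_downset D -> kappa D \in T_DMP A.
Proof. by move=> pD; rewrite inE; exists D. Qed.

Definition kappa_pt D (pD : proper_downset D) : T_DMP A :=
  SigSub (kappa_mem pD).

(** Trades a point for a down-set, so that inequalities in [M2] become membership statements. *)
Lemma kappa_ptE (s : T_DMP A) : exists D (pD : proper_downset D), s = kappa_pt pD.
Proof.
have /set_mem[D pD eD] := valP s.
by exists D, pD; apply/val_inj; rewrite /= eD.
Qed.

(** Points of this kind witness order reflection and, for [b = \bot], non-emptiness of the frame. *)
Lemma principal_downset_proper b :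
  b <> \top -> proper_downset [set a | a <= b].
Proof.
move=> bT; split=> [a c ac cb||Tb] /=; first exact: le_trans cb.
  exact: le0x.
by apply: bT; apply/le_anti; rewrite lex1.
Qed.

Lemma iA_morphism : dm_morphism (iA : A -> (T_DMP A -> M2)).
Proof.
split=> [a b ab|a||].
- apply/fun_leP => s; have [D [[dD D0 D1] ->]] := kappa_ptE s.
  apply/M2_leP; split.
    by move=> /hDP Da; apply/hDP => /(dD _ _ ab).
  by move=> /hDdualP Da; apply/hDdualP/(dD _ _ _ Da)/dmneg_anti.
- apply/funext => s; have [D [? ->]] := kappa_ptE s.
  (* The second coordinate at [a] is the negated first one at [dmneg a], which matches the swap of
     coordinates in [M2neg]. *)
  by congr pair; rewrite /= /hDdual ?negbK // dmnegK.
- apply/funext => s; have [D [[dD D0 D1] ->]] := kappa_ptE s.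
  by congr pair; [apply/hDP; exact|apply/hDdualP; rewrite dmneg0].
- apply/funext => s; have [D [[dD D0 D1] ->]] := kappa_ptE s.
  by congr pair; [apply/hDP|apply/hDdualP; rewrite dmnegT].
Qed.

Lemma iA_order_reflecting : order_reflecting (iA : A -> (T_DMP A -> M2)).
Proof.
move=> a b; split; last by case: iA_morphism => + _ _ _; apply.
move=> /fun_leP ab.
have [->|/eqP bT] := eqVneq b \top; first exact: lex1.
(* At the principal down-set of [b] the first coordinate of [b] is 0, hence so is that of [a], which
   means [a <= b]. *)
have /M2_leP[/= + _] := ab (kappa_pt (principal_downset_proper bT)).
by have [//|nab] := boolP (a <= b); case/(_ _)/hDP; [apply/hDP/negP|exact: lexx].
Qed.

End DownsetPoints.

Section PartialOperatorPoints.
Variables (d : Order.disp_t) (A : deMorganPosetType d) (G : A -> option A).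
Hypothesis hG1 : G \top = Some \top.
Hypothesis hGmono : forall x y gx gy : A,
  x <= y -> G x = Some gx -> G y = Some gy -> gx <= gy.
Hypothesis hGF : forall x y gx fy : A,
  x <= y -> G x = Some gx -> partialF G y = Some fy -> gx <= fy.
Implicit Types (D E : set A).

(** One clause per coordinate of [M2]; the first is contraposed and bounds [E] from above, the
    second bounds it from below. *)
Lemma R_G_kappaP D E (pD : proper_downset D) (pE : proper_downset E) :
  R_G G (kappa_pt pD) (kappa_pt pE) <->
  (forall x gx, G x = Some gx -> E x -> D gx) /\
  (forall x gx, G x = Some gx -> D (dmneg gx) -> E (dmneg x)).
Proof.
split=> [RDE|[ED DE] x gx Gx].
  split=> x gx Gx; have /M2_leP[/= h1 h2] := RDE x gx Gx.
    by move=> Ex; apply: contrapT => /hDP/h1/hDP.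
  by move=> /hDdualP/h2/hDdualP.
apply/M2_leP; split=> /=.
  by move=> /hDP Dgx; apply/hDP => /(ED _ _ Gx).
by move=> /hDdualP Dgx; apply/hDdualP/(DE _ _ Gx).
Qed.

(** The set L: the least down-set satisfying the second clause of [R_G_kappaP]. *)
Definition lower_successor D : set A :=
  [set z | exists x gx, [/\ G x = Some gx, D (dmneg gx) & z <= dmneg x]].

(** The complement of U: the largest down-set satisfying the first clause of [R_G_kappaP]. *)
Definition upper_successor D : set A :=
  [set z | forall x gx, G x = Some gx -> x <= z -> D gx].

Lemma lower_sub_upper D : proper_downset D ->
  lower_successor D `<=` upper_successor D.
Proof.
move=> [dD _ _] z [y [gy [Gy Dgy zy]]] x gx Gx xz.
(* Since F(y') = G(y)', condition (iii) for x <= y' gives G(x) <= G(y)', and G(y)' is in [D]. *)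
apply: dD Dgy; apply: hGF (le_trans xz zy) Gx _.
by rewrite /partialF dmnegK Gy.
Qed.

Lemma lower_bot D : proper_downset D -> lower_successor D \bot.
Proof. by case=> _ D0 _; exists \top, \top; rewrite dmnegT le0x. Qed.

Lemma upper_top D : proper_downset D -> ~ upper_successor D \top.
Proof. by move=> [_ _ D1] /(_ _ _ hG1 (lexx _)). Qed.

(** Disjointness of L and U keeps [\top], which is in U, out of L; dually, in the next lemma, it
    puts [\bot] into the complement of U. *)
Lemma lower_successor_proper D :
  proper_downset D -> proper_downset (lower_successor D).
Proof.
move=> pD; split; [|exact: lower_bot|].
  by move=> a b ab [x [gx [Gx Dgx bx]]]; exists x, gx; split=> //; apply: le_trans bx.
by move=> /(lower_sub_upper pD); apply: upper_top.
Qed.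

Lemma upper_successor_proper D :
  proper_downset D -> proper_downset (upper_successor D).
Proof.
move=> pD; split; [|exact: lower_sub_upper (lower_bot pD)|exact: upper_top].
by move=> a b ab Ub x gx Gx xa; apply: Ub Gx (le_trans xa ab).
Qed.

Lemma R_G_between D E (pD : proper_downset D) (pE : proper_downset E) :
  lower_successor D `<=` E -> E `<=` upper_successor D ->
  R_G G (kappa_pt pD) (kappa_pt pE).
Proof.
move=> LE EU; apply/R_G_kappaP; split=> x gx Gx.
  by move=> /EU /(_ _ _ Gx (lexx _)).
by move=> Dgx; apply: LE; exists x, gx.
Qed.

Lemma R_G_lower D (pD : proper_downset D) :
  R_G G (kappa_pt pD) (kappa_pt (lower_successor_proper pD)).
Proof. by apply: R_G_between; [|exact: lower_sub_upper]. Qed.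

Lemma R_G_upper D (pD : proper_downset D) :
  R_G G (kappa_pt pD) (kappa_pt (upper_successor_proper pD)).
Proof. by apply: R_G_between; [exact: lower_sub_upper|]. Qed.

Lemma R_G_serial : serial (R_G G).
Proof.
move=> s; have [D [pD ->]] := kappa_ptE s.
by eexists; apply: R_G_lower.
Qed.

Lemma hatG_iA a ga : G a = Some ga -> iA ga = hatG (R_G G) (iA a).
Proof.
move=> Ga; apply/funext => s; have [D [pD ->]] := kappa_ptE s.
have [lb_meet meet_glb] := M2meet_infimum [set iA a t | t in R_G G (kappa_pt pD)].
apply/le_anti/andP; split.
  (* This half is the definition of [R_G] at [a]. *)
  by apply: meet_glb => _ [t Rst <-]; apply: Rst.
have [dD _ _] := pD.
have le_t t : R_G G (kappa_pt pD) t ->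
    hatG (R_G G) (iA a) (kappa_pt pD) <= iA a t.
  by move=> Rst; apply: lb_meet; exists t.
apply/M2_leP; split=> [m1|m2] /=.
  have /M2_leP[/(_ m1)/hDP na _] := le_t _ (R_G_upper pD).
  (* If G(a) were in [D], then by (ii) so would be G(x) for every x <= a, placing [a] in the upper
     successor. *)
  apply/hDP => Dga; apply: na => x gx Gx xa.
  exact: dD (hGmono xa Gx Ga) Dga.
(* Here a' is in L, so a' <= y' for some [y] with G(y)' in [D]; then y <= a, and (ii) yields G(a)'
   <= G(y)'. *)
have /M2_leP[_ /(_ m2)/hDdualP[y [gy [Gy Dgy ay]]]] := le_t _ (R_G_lower pD).
apply/hDdualP; apply: dD Dgy; apply/dmneg_anti/(hGmono _ Gy Ga).
by rewrite -[y]dmnegK -[a]dmnegK; apply: dmneg_anti.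
Qed.

End PartialOperatorPoints.

Theorem mainTheorem2 (d : Order.disp_t) (A : deMorganPosetType d)
  (G : A -> option A)
  (hG0 : G \bot = Some \bot) (hG1 : G \top = Some \top)
  (hGmono : forall x y gx gy : A,
     x <= y -> G x = Some gx -> G y = Some gy -> gx <= gy)
  (hGF : forall x y gx fy : A,
     x <= y -> G x = Some gx -> partialF G y = Some fy -> gx <= fy) :
  [/\ (\bot <> \top :> A -> is_frame (R_G G)) /\ serial (R_G G),
      complete_lattice (T_DMP A -> M2),
      dm_morphism (iA : A -> (T_DMP A -> M2)) /\ order_reflecting (iA : A -> (T_DMP A -> M2)),
      forall a ga : A, G a = Some ga -> iA ga = hatG (R_G G) (iA a)
    & forall a fa : A, partialF G a = Some fa -> iA fa = hatF (R_G G) (iA a)].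
Proof.
have iAneg : forall a : A, iA (dmneg a) = dmneg (iA a) by case: (iA_morphism A).
split.
- split; last exact: R_G_serial.
  by move=> /principal_downset_proper pD; exists (kappa_pt pD).
- exact: M2_power_complete.
- by split; [exact: iA_morphism|exact: iA_order_reflecting].
- by move=> a ga; apply: hatG_iA.
(* As F(a) = G(a')' and [iA] commutes with negation, this is the claim for [G] at a', negated. *)
- move=> a fa; rewrite /partialF; case Ga: (G (dmneg a)) => [ga|] //= [<-].
  by rewrite iAneg (hatG_iA hG1 hGmono hGF Ga) iAneg.
Qed.
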